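(* Let $n\ge 1$, let $G=A_n$, let $\prec$ be an eliminating order on $V=\{1,\dots,n\}$, and let $M$ be the maximal element of $V$ with respect to $\prec$. Then for all $\underline{s}=(s_1,\dots,s_n)\in\mathbb{R}^n$ and all $y\in P_G$, $$\delta_{\underline{s}}^{\prec}(\pi(y^{-1}))=\Delta_{-\underline{s}}^{\prec}(y)=\Delta_{-\underline{s}}^{(M)}(y).$$
   Context: $G=A_n$ is the path graph $1-2-\cdots-n$ on $V=\{1,\dots,n\}$: $v\sim w$ iff $|v-w|=1$; $E=\{(i,j)\in V\times V: |i-j|\le 1\}$. $S_n$ is the space of real symmetric $n\times n$ matrices, $Z_G=\{y\in S_n: y_{ij}=0 \text{ if }(i,j)\notin E\}$, and $P_G$ is the set of positive definite $y\in Z_G$. $I_G$ is the dual space of $Z_G$, realised as the space of incomplete symmetric matrices $\eta=(\eta_{ij})_{(i,j)\in E}$ (only the entries indexed by $E$ are given), with pairing $\langle y,\eta\rangle=\mathrm{tr}(y\eta)=\sum_{(i,j)\in E}y_{ij}\eta_{ij}$. $Q_G\subset I_G$ is the dual cone: $Q_G=\{\eta\in I_G:\langle y,\eta\rangle>0\ \forall y\in\overline{P_G}\setminus\{0\}\}$. $\pi:S_n\to I_G$ keeps the entries indexed by $E$; it is known that $y\mapsto\pi(y^{-1})$ maps $P_G$ bijectively onto $Q_G$. For $I\subset V$, $y_I$ is the submatrix with rows and columns in $I$; $\{i:j\}=\{i,i+1,\dots,j\}$; $|\cdot|$ denotes the determinant. For a total order $\prec$ on $V$, $v^+=\{w\in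 V: v\prec w,\ v\sim w\}$ (future neighbours) and $v^-=\{u\in V: u\prec v\}$ (predecessors). The order $\prec$ is eliminating if $v^+$ is complete (any two distinct elements adjacent) for all $v\in V$. With $\det y_\emptyset=\det\eta_\emptyset=1$, $$\Delta^{\prec}_{\underline{s}}(y)=\prod_{v\in V}\Bigl(\frac{\det y_{\{v\}\cup v^-}}{\det y_{v^-}}\Bigr)^{s_v}\ (y\in P_G),\qquad \delta^{\prec}_{\underline{s}}(\eta)=\prod_{v\in V}\Bigl(\frac{\det \eta_{\{v\}\cup v^+}}{\det \eta_{v^+}}\Bigr)^{s_v}\ (\eta\in Q_G).$$ For $M\in V$ and $y\in P_G$, $$\Delta^{(M)}_{\underline{s}}(y)=\prod_{i=1}^{M-1}|y_{\{1:i\}}|^{s_i-s_{i+1}}\;|y|^{s_M}\prod_{i=M+1}^{n}|y_{\{i:n\}}|^{s_i-s_{i-1}}.$$ *)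

(* Defs.v *)
From HB Require Import structures.
From mathcomp Require Export all_boot all_order all_algebra.
From mathcomp Require Export reals exp.

Set Implicit Arguments.
Unset Strict Implicit.
Unset Printing Implicit Defensive.

Import Order.TTheory GRing.Theory Num.Theory.
Local Open Scope ring_scope.

(* The vertices 1, ..., n of the path A_n are represented by 0, ..., n-1 in
   'I_n; adjacency and the intervals {i:j} are unaffected by this shift. *)

Section Graph.
Variable n : nat.
Implicit Types (v w : 'I_n) (prec : rel 'I_n).

Definition adj : rel 'I_n := fun v w => `|v%:Z - w%:Z| == 1.

Definition edge_rel : rel 'I_n := fun v w => `|v%:Z - w%:Z| <= 1.

Definition edge := {e : 'I_n * 'I_n | edge_rel e.1 e.2}.

Definition complete (K : {set 'I_n}) : Prop :=
  forall v w, v \in K -> w \in K -> v != w -> adj v w.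

Definition strict_total_order prec : Prop :=
  [/\ irreflexive prec, transitive prec
    & forall v w, v != w -> prec v w || prec w v].

Definition future prec v : {set 'I_n} := [set w | prec v w && adj v w].

(* All predecessors, not only the neighbouring ones. *)
Definition past prec v : {set 'I_n} := [set u | prec u v].

Definition eliminating prec : Prop := forall v, complete (future prec v).

Definition maximal_for prec (M : 'I_n) : Prop := forall v, ~~ prec M v.

Definition vrange (i j : nat) : {set 'I_n} := [set k : 'I_n | (i <= k <= j)%N].

End Graph.

Section Matrices.
Variables (R : realType) (n : nat).
Implicit Types (y : 'M[R]_n) (s : 'rV[R]_n) (prec : rel 'I_n).

Definition in_ZG y : Prop :=
  y \is symmetricmx /\ forall i j, ~~ edge_rel i j -> y i j = 0.

Definition posdef y : Prop :=
  forall x : 'rV[R]_n, x != 0 -> 0 < (x *m y *m x^T) 0 0.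

Definition in_PG y : Prop := in_ZG y /\ posdef y.

(* Only the entries indexed by E are stored.  Symmetry is not built into the
   type: the families obtained from symmetric matrices through [proj_E] are
   symmetric. *)
Definition incomplete := {ffun edge n -> R}.

Definition proj_E y : incomplete :=
  [ffun e => y (val e).1 (val e).2].

(* The value 0 at (i, j) outside E is a placeholder; it is never read when
   i and j range over a complete set of vertices. *)
Definition entry (eta : incomplete) (i j : 'I_n) : R :=
  if insub (i, j) is Some e then eta e else 0.

(* [enum_val] enumerates I in increasing order. *)
Definition submx_on y (I : {set 'I_n}) : 'M[R]_#|I| :=
  mxsub (@enum_val _ (mem I)) (@enum_val _ (mem I)) y.

(* Meaningful for I complete, as is v |: future prec v for prec eliminating. *)
Definition isubmx_on (eta : incomplete) (I : {set 'I_n}) : 'M[R]_#|I| :=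
  \matrix_(i, j) entry eta (enum_val i) (enum_val j).

Definition Delta prec s y : R :=
  \prod_(v < n) (\det (submx_on y (v |: past prec v))
                 / \det (submx_on y (past prec v))) `^ s 0 v.

(* Intended for eta in Q_G, where all the determinants are positive. *)
Definition delta prec s (eta : incomplete) : R :=
  \prod_(v < n) (\det (isubmx_on eta (v |: future prec v))
                 / \det (isubmx_on eta (future prec v))) `^ s 0 v.

(* [ordS] and [ord_pred] are cyclic, but i < M (resp. M < i) rules out
   wrap-around, so that they are i + 1 (resp. i - 1) here. *)
Definition DeltaM (M : 'I_n) s y : R :=
  (\prod_(i < n | (i < M)%N)
      \det (submx_on y (vrange n 0 i)) `^ (s 0 i - s 0 (ordS i)))
  * \det y `^ s 0 M
  * (\prod_(i < n | (M < i)%N)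
      \det (submx_on y (vrange n i n.-1)) `^ (s 0 i - s 0 (ord_pred i))).

End Matrices.

(* Main.v *)
Require Import Defs.
From mathcomp Require Import fingroup perm zify ring.

Set Implicit Arguments.
Unset Strict Implicit.
Unset Printing Implicit Defensive.

Import Order.TTheory GRing.Theory Num.Theory.
Local Open Scope ring_scope.

(** Both identities become statements about principal minors of y.  Write
    y_I for the block of y on I and r(S, v) = |y_S| / |y_(S minus v)|.

    Since prec is eliminating, a vertex of the path cannot have both of its
    neighbours in its future; descending from the maximum M, it follows that
    prec increases towards M on either side ([eliminating_toward]).  Let C_v be
    [branch M v], the set of vertices on the far side of v as seen from M, v
    included, and the whole path when v = M.  Then C_v is contained in
    v |: past v, which is contained in the complement of future v, and every
    edge leaving C_v ends in future v.  Hence on any S between C_v and the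
    complement of future v, the matrix y_S is block diagonal with C_v as a
    block, and r(S, v) = r(C_v, v) ([ratio_branch]).

    The v-th factor of Delta is r(v |: past v, v), hence r(C_v, v).  By Jacobi's
    complementary minor formula ([minor_invmx]) the v-th factor of delta at
    y^-1 is the inverse of r(complement of future v, v), hence 1 / r(C_v, v).
    This gives the first identity.

    For the second one, C_v is an initial segment of the path for v < M and a
    final one for M < v, so that the product of the r(C_v, v) ^ t_v over each
    side telescopes into the powers of the corner minors in DeltaM.  Each side
    leaves over one factor at M, and the two of them turn |y| ^ t_M into
    r(C_M, M) ^ t_M.

    Positive definiteness makes all these minors positive
    ([posdef_minor_gt0]), as the rules for real powers require. *)

(** * Principal minors *)

Lemma det_mxsub_bij (R : comPzRingType) (m n : nat) (f : 'I_m -> 'I_n)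
    (A : 'M[R]_n) : bijective f -> \det (mxsub f f A) = \det A.
Proof.
move=> f_bij; have eq_mn : m = n by rewrite -(card_ord m) (bij_eq_card f_bij) card_ord.
subst m; set p := perm (bij_inj f_bij).
have -> : mxsub f f A = row_perm p (col_perm p A).
  by apply/matrixP=> i j; rewrite !mxE !permE.
rewrite row_permE col_permE !det_mulmx !det_perm odd_permV.
by rewrite mulrC -mulrA -signr_addb addbb mulr1.
Qed.

Section Minors.
Variables (R : realType) (n : nat).
Implicit Types (A B y : 'M[R]_n) (I J C S : {set 'I_n}).

Definition minor A I : R := \det (submx_on A I).

Lemma eq_minor A B I :
  {in I &, forall i j, A i j = B i j} -> minor A I = minor B I.
Proof.
move=> eqAB; congr (\det _); apply/matrixP=> i j.
by rewrite !mxE eqAB ?enum_valP.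
Qed.

Lemma minor1 I : minor 1%:M I = 1.
Proof.
rewrite -[RHS](det1 _ #|I|); congr (\det _); apply/matrixP=> i j.
by rewrite !mxE (inj_eq enum_val_inj).
Qed.

Lemma minor_set0 A : minor A set0 = 1.
Proof. by rewrite -(minor1 set0); apply: eq_minor => i; rewrite inE. Qed.

(** Listing I before its complement makes A block triangular, and a
    simultaneous permutation of rows and columns preserves the determinant. *)
Lemma det_blocktriangular A I :
  (forall i j, i \in I -> j \notin I -> A i j = 0) ->
  \det A = minor A I * minor A (~: I).
Proof.
move=> A0.
pose f (k : 'I_(#|I| + #|~: I|)) : 'I_n :=
  match split k with inl i => enum_val i | inr j => enum_val j end.
have fI : injective f.
  move=> k l; rewrite /f; case: (split_ordP k) => i ->; case: (split_ordP l) => j ->.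
  - by move=> /enum_val_inj->.
  - by move=> e; have := enum_valP j; rewrite -e inE enum_valP.
  - by move=> e; have := enum_valP i; rewrite e inE enum_valP.
  - by move=> /enum_val_inj->.
have f_bij : bijective f.
  by apply: inj_card_bij fI _; rewrite !card_ord cardsC card_ord.
rewrite -(det_mxsub_bij A f_bij).
have fl i : f (lshift _ i) = enum_val i by rewrite /f -[lshift _ i]/(unsplit (inl i)) unsplitK.
have fr i : f (rshift _ i) = enum_val i by rewrite /f -[rshift _ i]/(unsplit (inr i)) unsplitK.
rewrite -[mxsub f f A]submxK.
have -> : ursubmx (mxsub f f A) = 0.
  apply/matrixP=> i j; rewrite !mxE fl fr A0 ?enum_valP //.
  by have := enum_valP j; rewrite inE.
rewrite det_lblock; congr (_ * _); congr (\det _).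
  by apply/matrixP=> i j; rewrite !mxE !fl.
by apply/matrixP=> i j; rewrite !mxE !fr.
Qed.

Lemma minor_setT A : minor A setT = \det A.
Proof.
rewrite (@det_blocktriangular A setT) => [|i j _]; last by rewrite inE.
by rewrite setCT minor_set0 mulr1.
Qed.

(** The block of A on I completed by an identity block: a matrix of fixed size
    whose determinant is the minor on I, so that [det_blocktriangular] applies
    to minors as well. *)
Definition pad A I : 'M[R]_n :=
  \matrix_(i, j) if (i \in I) && (j \in I) then A i j else (i == j)%:R.

Lemma det_pad A I : \det (pad A I) = minor A I.
Proof.
rewrite (@det_blocktriangular _ I); last first.
  move=> i j iI jI; rewrite mxE (negbTE jI) andbF.
  by case: eqP => // eij; rewrite -eij iI in jI.
rewrite -[RHS]mulr1 -(minor1 (~: I)); congr (_ * _); apply: eq_minor => i j.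
  by move=> iI jI; rewrite mxE iI jI.
by rewrite !inE => /negbTE iI _; rewrite !mxE iI.
Qed.

Lemma minor_setU A I J : [disjoint I & J] ->
  {in I & J, forall i j, A i j = 0} ->
  minor A (I :|: J) = minor A I * minor A J.
Proof.
move=> dIJ A0.
have IJ i : i \in I -> (i \in J) = false by apply: disjointFr.
rewrite -(det_pad A (I :|: J)) -(det_pad A J) !(@det_blocktriangular _ I).
- have -> : minor (pad A J) I = 1.
    rewrite -(minor1 I); apply: eq_minor => i j iI jI.
    by rewrite !mxE (IJ i).
  rewrite mul1r; congr (_ * _); apply: eq_minor => i j.
    by move=> iI jI; rewrite mxE !inE iI jI.
  by rewrite !inE => /negbTE iI /negbTE jI; rewrite !mxE !inE iI jI.
- move=> i j iI jI; rewrite mxE (IJ i) //=.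
  by case: eqP => // eij; rewrite -eij iI in jI.
- move=> i j iI jI; rewrite mxE !inE iI (negbTE jI) /=.
  case: ifP => jJ; first exact: A0.
  by case: eqP => // eij; rewrite -eij iI in jI.
Qed.

(** Jacobi's complementary minor formula.  Replacing the rows of the identity
    indexed by I with those of A^-1 gives a matrix E of determinant
    minor A^-1 I; multiplying by A turns these rows back into rows of the
    identity and the other ones into rows of A, so that E *m A has determinant
    minor A (~: I). *)
Lemma minor_invmx A I : A \in unitmx ->
  minor (invmx A) I * \det A = minor A (~: I).
Proof.
move=> Au; set B := invmx A.
pose E : 'M[R]_n := \matrix_(i, j) if i \in I then B i j else (i == j)%:R.
have detE : \det E = minor B I.
  rewrite (@det_blocktriangular _ (~: I)); last first.
    move=> i j; rewrite !inE negbK mxE => /negbTE iI jI; rewrite iI.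
    by case: eqP => // eij; rewrite eij jI in iI.
  rewrite setCK -[RHS]mul1r -(minor1 (~: I)); congr (_ * _); apply: eq_minor => i j.
    by rewrite !inE !mxE => /negbTE->.
  by rewrite mxE => ->.
have EA : E *m A = \matrix_(i, j) if i \in I then (i == j)%:R else A i j.
  have BA : B *m A = 1%:M by rewrite mulVmx.
  apply/matrixP=> i j; rewrite !mxE; case: ifP => iI.
    move/matrixP/(_ i j): BA; rewrite !mxE => <-.
    by apply: eq_bigr => k _; rewrite mxE iI.
  rewrite (bigD1 i) //= mxE iI eqxx mul1r big1 ?addr0 // => k ki.
  by rewrite mxE iI eq_sym (negbTE ki) mul0r.
rewrite -detE -det_mulmx EA (@det_blocktriangular _ I); last first.
  move=> i j iI jI; rewrite mxE iI.
  by case: eqP => // eij; rewrite -eij iI in jI.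
rewrite -[RHS]mul1r; congr (_ * _); [rewrite -[RHS](minor1 I)|];
  apply: eq_minor => i j; first by rewrite !mxE => ->.
by rewrite !inE !mxE => /negbTE->.
Qed.

End Minors.

(** * Positivity of the minors *)

Section PosDef.
Variable R : realType.

Lemma posdef_unitmx (n : nat) (A : 'M[R]_n) : posdef A -> A \in unitmx.
Proof.
move=> A_pos; rewrite -row_free_unit -kermx_eq0.
apply/negPn/negP => /rowV0Pn[x /sub_kermxP xA0 x0].
by have := A_pos x x0; rewrite xA0 mul0mx mxE ltxx.
Qed.

(** The quadratic form of the submatrix is that of A restricted to vectors
    supported on the image of f: x is sent to x *m P for a matrix P with
    orthonormal rows. *)
Lemma posdef_mxsub (m n : nat) (f : 'I_m -> 'I_n) (A : 'M[R]_n) :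
  injective f -> posdef A -> posdef (mxsub f f A).
Proof.
move=> f_inj A_pos x x_neq0; pose P : 'M[R]_(m, n) := rowsub f 1%:M.
have mxsubE B : mxsub f f B = P *m B *m P^T.
  rewrite -mulmxA -rowsubE; apply/matrixP=> i j; rewrite !mxE.
  rewrite (bigD1 (f j)) //= big1 ?addr0 => [|k kj]; last first.
    by rewrite !mxE eq_sym (negbTE kj) mulr0.
  by rewrite !mxE eqxx mulr1.
have xP_neq0 : x *m P != 0.
  apply: contra_neq x_neq0 => xP0.
  have PP1 : P *m P^T = 1%:M.
    have := mxsubE 1%:M; rewrite mulmx1 => <-.
    by apply/matrixP=> i j; rewrite !mxE (inj_eq f_inj).
  by rewrite -[x]mulmx1 -PP1 mulmxA xP0 mul0mx.
by have := A_pos _ xP_neq0; rewrite trmx_mul mxsubE !mulmxA.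
Qed.

(** If x is the row i of A^-1, then x *m A is the i-th basis vector and the
    quadratic form of A at x is the entry (i, i) of A^-1. *)
Lemma posdef_invmx_diag (n : nat) (A : 'M[R]_n) i : posdef A -> 0 < invmx A i i.
Proof.
move=> A_pos; have Au := posdef_unitmx A_pos.
have x_neq0 : row i (invmx A) != 0.
  apply/eqP=> /(congr1 (mulmx^~ A)); rewrite -row_mul mulVmx // mul0mx.
  by move=> /rowP/(_ i)/eqP; rewrite !mxE eqxx oner_eq0.
have := A_pos _ x_neq0.
by rewrite -row_mul mulVmx // row1 -rowE !mxE.
Qed.

(** By Cramer's rule the (0, 0) entry of A^-1 is the ratio of a smaller
    determinant, positive by induction, to that of A. *)
Lemma posdef_det_gt0 (n : nat) (A : 'M[R]_n) : posdef A -> 0 < \det A.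
Proof.
elim: n A => [|n IHn] A A_pos; first by rewrite det_mx00.
have A00 := posdef_invmx_diag 0 A_pos; have Au := posdef_unitmx A_pos.
have : 0 < cofactor A 0 0.
  rewrite /cofactor addn0 expr0 mul1r.
  have -> : row' 0 (col' 0 A) = mxsub (lift 0) (lift 0) A by apply/matrixP=> i j; rewrite !mxE.
  by apply: IHn; apply: posdef_mxsub => //; apply: lift_inj.
move: A00; rewrite /invmx Au !mxE => A00 c_gt0.
by rewrite -invr_gt0 -(pmulr_lgt0 _ c_gt0).
Qed.

Lemma posdef_minor_gt0 (n : nat) (A : 'M[R]_n) (I : {set 'I_n}) :
  posdef A -> 0 < minor A I.
Proof.
by move=> A_pos; apply/posdef_det_gt0/posdef_mxsub => //; apply: enum_val_inj.
Qed.

End PosDef.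

(** * Eliminating orders on a path *)

Section PathOrder.
Variable n : nat.
Implicit Types (i j u v w M : 'I_n) (prec : rel 'I_n).

Lemma adjE v w : adj v w = (v.+1 == w :> nat) || (w.+1 == v :> nat).
Proof. by rewrite /adj; apply/idP/idP; lia. Qed.

Lemma edge_relE v w : edge_rel v w = (v == w) || adj v w.
Proof. by rewrite adjE /edge_rel -val_eqE /=; apply/idP/idP; lia. Qed.

(** On the way from v to M along the path, w is met after v. *)
Definition toward M v w := (v < w <= M)%N || (M <= w < v)%N.

(** Neighbours come first, by induction on the distance from w to M.  For w = M
    this is maximality.  Otherwise the next vertex u towards M lies in the
    future of w; if v did not precede w, then v would lie there too, although
    v and u are distinct and not adjacent.  Distant vertices follow by
    transitivity. *)
Lemma eliminating_toward prec M v w : strict_total_order prec ->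
  eliminating prec -> maximal_for prec M -> toward M v w -> prec v w.
Proof.
move=> [_ prec_trans prec_total] prec_elim M_max.
have prec_neighbour : forall k u v, `|M - u|%N = k -> adj u v -> toward M v u -> prec v u.
  elim=> [|k IHk] {}w {}v dist_w; rewrite adjE => vw_adj v_to_w.
    have -> : w = M by apply/val_inj => /=; lia.
    have vM : v != M by rewrite -val_eqE /=; move: v_to_w; rewrite /toward; lia.
    by have := prec_total _ _ vM; rewrite (negbTE (M_max v)) orbF.
  have [u uE] : exists u : 'I_n, u = (if (w < M)%N then w.+1 else w.-1) :> nat.
    have lt_u : ((if (w < M)%N then w.+1 else w.-1) < n)%N.
      by have := ltn_ord M; have := ltn_ord w; case: ifP; lia.
    by exists (Ordinal lt_u).
  have vw : v != w by rewrite -val_eqE /=; lia.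
  have wu : prec w u.
    by apply: IHk; move: v_to_w uE; rewrite ?adjE /toward; case: ifP; lia.
  have := prec_total _ _ vw; case/orP => // wv.
  have := prec_elim w u v; rewrite !inE wu wv !adjE -val_eqE /=.
  by move: v_to_w uE; rewrite /toward; case: ifP; lia.
have: forall k u v, `|v - u|%N = k.+1 -> toward M v u -> prec v u.
  elim=> [|k IHk] {}w {}v dist_vw v_to_w.
    by apply: (prec_neighbour _ _ _ erefl) => //; rewrite adjE; lia.
  have [u uE] : exists u : 'I_n, u = (if (w < v)%N then w.+1 else w.-1) :> nat.
    have lt_u : ((if (w < v)%N then w.+1 else w.-1) < n)%N.
      by have := ltn_ord v; have := ltn_ord w; case: ifP; lia.
    by exists (Ordinal lt_u).
  apply: (prec_trans u).
    by apply: IHk; move: v_to_w uE; rewrite /toward; case: ifP; lia.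
  by apply: (prec_neighbour _ _ _ erefl); move: v_to_w uE; rewrite ?adjE /toward; case: ifP; lia.
move=> H v_to_w; apply: (H `|v - w|.-1%N) => //.
by move: v_to_w; rewrite /toward; lia.
Qed.

(** The component of v in the path once the next vertex towards M is removed;
    both implications are vacuous at v = M, where it is the whole path. *)
Definition branch M v : {set 'I_n} :=
  [set i : 'I_n | ((v < M) ==> (i <= v))%N && ((M < v) ==> (v <= i))%N].

Section Order.
Variables (prec : rel 'I_n) (M : 'I_n).
Hypotheses (prec_order : strict_total_order prec).
Hypotheses (prec_elim : eliminating prec) (M_max : maximal_for prec M).

Lemma branch_sub_past v : branch M v \subset v |: past prec v.
Proof.
apply/subsetP=> i; rewrite !inE => iC; apply/orP.
have [->|iv] := eqVneq i v; [by left | right].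
apply: (eliminating_toward prec_order prec_elim M_max).
by move: iC iv; rewrite -val_eqE /= /toward; lia.
Qed.

Lemma past_sub_nonfuture v : v |: past prec v \subset ~: future prec v.
Proof.
have [prec_irr prec_trans _] := prec_order.
apply/subsetP=> i; rewrite !inE => /predU1P[->|iv]; first by rewrite prec_irr.
apply/negP=> /andP[vi _]; have := prec_trans _ _ _ iv vi.
by rewrite prec_irr.
Qed.

(** An edge can leave the branch only from v to the next vertex towards M,
    which lies in the future of v. *)
Lemma branch_boundary v i j : i \in branch M v -> j \notin branch M v ->
  edge_rel i j -> j \in future prec v.
Proof.
rewrite edge_relE => iC jC /predU1P[ij|ij]; first by rewrite -ij iC in jC.
have vj : toward M v j.
  by move: iC jC ij; rewrite /toward !inE adjE; lia.
rewrite inE (eliminating_toward prec_order prec_elim M_max vj) /=.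
by move: iC jC ij; rewrite !inE !adjE; lia.
Qed.

Lemma closed_future_clique v :
  {in v |: future prec v &, forall i j, edge_rel i j}.
Proof.
move=> i j; rewrite !inE => /predU1P[->|vi] /predU1P[->|vj].
- by rewrite edge_relE eqxx.
- by rewrite edge_relE; case/andP: vj => _ ->; rewrite orbT.
- by rewrite edge_relE adjE orbC [(_ == _) || (_ == _)]orbC -adjE; case/andP: vi => _ ->.
- rewrite edge_relE; case: eqVneq => //= ij.
  by apply: (prec_elim (v := v)) => //; rewrite inE.
Qed.

End Order.
End PathOrder.

(** * Ratios of minors as factors of Delta and delta *)

Section Ratios.
Variables (R : realType) (n : nat).
Implicit Types (A y : 'M[R]_n) (C I S : {set 'I_n}) (v M : 'I_n) (prec : rel 'I_n).

Definition ratio A S v : R := minor A S / minor A (S :\ v).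

(** The block of A on the rest of S contributes the same factor to both
    minors. *)
Lemma ratio_component A C S v : posdef A -> v \in C -> C \subset S ->
  (forall i j, i \in C -> j \in S :\: C -> A i j = 0) ->
  ratio A S v = ratio A C v.
Proof.
move=> A_pos vC CS A0.
have minor_split (D : {set 'I_n}) :
    D \subset C ->
    minor A (D :|: (S :\: C)) = minor A D * minor A (S :\: C).
  move=> DC; apply: minor_setU => [|i j iD jS].
    by rewrite -setI_eq0 -subset0; apply/subsetP=> i; rewrite !inE => /and3P[/(subsetP DC) ->].
  by apply: A0 => //; apply: (subsetP DC).
have S_split : S = C :|: (S :\: C).
  by apply/setP=> i; rewrite !inE; case: (boolP (i \in C)) => //= /(subsetP CS).
have Sv_split : S :\ v = (C :\ v) :|: (S :\: C).
  apply/setP=> i; rewrite {1}S_split !inE; case: (eqVneq i v) => // ->.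
  by rewrite vC.
rewrite /ratio {1}S_split Sv_split !minor_split ?subsetDl // invfM mulrACA.
by rewrite divff ?mulr1 // gt_eqF ?posdef_minor_gt0.
Qed.

(** In Jacobi's formula the complement of S :\ v is larger than that of S, hence
    the inverse; the two factors \det A cancel. *)
Lemma ratio_invmx A S v : posdef A -> v \in S ->
  ratio (invmx A) S v = (ratio A (~: (S :\ v)) v)^-1.
Proof.
move=> A_pos vS; have Au := posdef_unitmx A_pos.
have det_neq0 : \det A != 0 by rewrite gt_eqF ?posdef_det_gt0.
have minorE I : minor (invmx A) I = minor A (~: I) / \det A.
  by rewrite -minor_invmx // mulfK.
rewrite /ratio !minorE !invf_div.
have -> : ~: (S :\ v) :\ v = ~: S.
  by apply/setP=> i; rewrite !inE; case: eqVneq => //= ->; rewrite vS.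
by rewrite mulrA divfK.
Qed.

(** When I is a clique, no placeholder value is read. *)
Lemma det_isubmx_on A I : {in I &, forall i j, edge_rel i j} ->
  \det (isubmx_on (proj_E A) I) = minor A I.
Proof.
move=> I_edge; congr (\det _); apply/matrixP=> i j; rewrite !mxE /entry.
have e : edge_rel (enum_val i) (enum_val j) by apply: I_edge; apply: enum_valP.
by rewrite insubT ffunE.
Qed.

Section Order.
Variables (prec : rel 'I_n) (M : 'I_n).
Hypotheses (prec_order : strict_total_order prec).
Hypotheses (prec_elim : eliminating prec) (M_max : maximal_for prec M).

Lemma ratio_branch A S v : in_PG A -> v \in S ->
  branch M v \subset S -> S \subset ~: future prec v ->
  ratio A S v = ratio A (branch M v) v.
Proof.
move=> [[_ A0] A_pos] vS CS SF; apply: ratio_component => //.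
  by rewrite inE leqnn !implybT.
move=> i j iC; rewrite inE => /andP[jC /(subsetP SF)]; rewrite inE => jF.
apply: A0; apply: contra jF.
exact: branch_boundary prec_order prec_elim M_max _ _ _ iC jC.
Qed.

Lemma past_notin v : v \notin past prec v.
Proof. by case: prec_order => prec_irr _ _; rewrite inE prec_irr. Qed.

Lemma future_notin v : v \notin future prec v.
Proof. by case: prec_order => prec_irr _ _; rewrite inE prec_irr. Qed.

Lemma DeltaE t A : in_PG A ->
  Delta prec t A = \prod_(v < n) ratio A (branch M v) v `^ t 0 v.
Proof.
move=> A_PG; apply: eq_bigr => v _; congr (_ `^ _).
rewrite -(@ratio_branch A (v |: past prec v)) ?setU11 ?past_sub_nonfuture //.
  by rewrite /ratio setU1K ?past_notin.
exact: branch_sub_past.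
Qed.

(** Inversion replaces v |: future v by the complement of future v, a set to
    which [ratio_branch] applies. *)
Lemma deltaE s A : in_PG A ->
  delta prec s (proj_E (invmx A)) =
  \prod_(v < n) (ratio A (branch M v) v)^-1 `^ s 0 v.
Proof.
move=> A_PG; apply: eq_bigr => v _; congr (_ `^ _).
have K_edge := closed_future_clique prec_elim (v := v).
rewrite !det_isubmx_on //; last first.
  by move=> i j iF jF; apply: K_edge; rewrite inE ?iF ?jF orbT.
rewrite -{2}(setU1K (future_notin v)) -/(ratio _ _ _).
rewrite (ratio_invmx (proj2 A_PG) (setU11 _ _)) setU1K ?future_notin //.
rewrite ratio_branch //; first by rewrite inE future_notin.
apply: subset_trans (branch_sub_past prec_order prec_elim M_max v) _.
exact: past_sub_nonfuture.
Qed.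

End Order.

(** * Telescoping of the corner minors *)

(** Abel summation in the exponents; L 0 = 1 removes one boundary term, and
    the other one is the last factor. *)
Lemma powR_telescope (m : nat) (L t : nat -> R) :
  (forall k, 0 < L k) -> L 0 = 1 ->
  \prod_(i < m) L i.+1 `^ (t i - t i.+1) =
  (\prod_(i < m) (L i.+1 / L i) `^ t i) * L m `^ (- t m).
Proof.
move=> L_gt0 L0; elim: m => [|m IHm]; first by rewrite !big_ord0 L0 powR1 mulr1.
rewrite !big_ord_recr /= IHm -!mulrA; congr (_ * _).
have L_neq0 : L m.+1 != 0 by rewrite gt_eqF.
rewrite powRD ?L_neq0 ?implybT // powRM ?invr_ge0 ?(ltW (L_gt0 _)) //.
rewrite -[(L m)^-1]powR_inv1 ?(ltW (L_gt0 _)) // -powRrM mulN1r.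
by rewrite -!mulrA mulrCA.
Qed.

Lemma powR_telescope_ord M (L : nat -> R) (t : 'I_n -> R) :
  (forall k, 0 < L k) -> L 0 = 1 ->
  \prod_(i < n | (i < M)%N) L i.+1 `^ (t i - t (ordS i)) =
  (\prod_(i < n | (i < M)%N) (L i.+1 / L i) `^ t i) * L M `^ (- t M).
Proof.
move=> L_gt0 L0; pose t' k := t (insubd M k).
have t'E (i : 'I_n) k : i = k :> nat -> t i = t' k.
  by move=> <-; rewrite /t' valKd.
(* At i = M.-1 this reads t' at M, still a vertex, so that the default value
   of [insubd] never matters. *)
have := powR_telescope M t' L_gt0 L0.
rewrite (big_ord_widen n (fun i => L i.+1 `^ (t' i - t' i.+1))) ?(ltnW (ltn_ord M)) //.
rewrite (big_ord_widen n (fun i => (L i.+1 / L i) `^ t' i)) ?(ltnW (ltn_ord M)) //.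
rewrite -(t'E M) // => telescope.
under [in RHS]eq_bigr => i _ do rewrite (t'E i i erefl).
rewrite -telescope; apply: eq_bigr => i iM; rewrite (t'E i i) // (t'E _ i.+1) //=.
by rewrite modn_small //; apply: leq_ltn_trans iM (ltn_ord M).
Qed.

(** Corner minors of size k: reversing the path turns the lower right corners
    into upper left ones, so that both sides of M telescope in the same way. *)
Definition lower_minor A k : R := minor A [set i : 'I_n | (i < k)%N].

Definition upper_minor A k : R := minor A [set i : 'I_n | (rev_ord i < k)%N].

Lemma lower_minor0 A : lower_minor A 0 = 1.
Proof. by rewrite -(minor_set0 A); congr minor; apply/setP=> i; rewrite !inE. Qed.

Lemma upper_minor0 A : upper_minor A 0 = 1.
Proof. by rewrite -(minor_set0 A); congr minor; apply/setP=> i; rewrite !inE. Qed.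

Lemma ratio_branch_lt A M v : (v < M)%N ->
  ratio A (branch M v) v = lower_minor A v.+1 / lower_minor A v.
Proof.
move=> vM; congr (minor A _ / minor A _); apply/setP=> i.
  by rewrite !inE; lia.
by rewrite !inE -val_eqE /=; lia.
Qed.

Lemma ratio_branch_gt A M v : (M < v)%N ->
  ratio A (branch M v) v =
  upper_minor A (rev_ord v).+1 / upper_minor A (rev_ord v).
Proof.
move=> vM; congr (minor A _ / minor A _); apply/setP=> i.
  by rewrite !inE /=; have := ltn_ord i; have := ltn_ord v; lia.
by rewrite !inE -val_eqE /=; have := ltn_ord i; have := ltn_ord v; lia.
Qed.

(** Removing M cuts the path into two parts with no edge between them. *)
Lemma ratio_branch_eq A M : in_ZG A ->
  ratio A (branch M M) M =
  \det A / (lower_minor A M * upper_minor A (rev_ord M)).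
Proof.
move=> [_ A0].
have -> : branch M M = setT by apply/setP=> i; rewrite !inE !ltnn.
rewrite /ratio minor_setT; congr (_ / _).
rewrite -minor_setU.
- congr minor; apply/setP=> i; rewrite !inE -val_eqE /=.
  by have := ltn_ord i; have := ltn_ord M; lia.
- rewrite -setI_eq0 -subset0; apply/subsetP=> i; rewrite !inE /=.
  by have := ltn_ord i; have := ltn_ord M; lia.
- move=> i j; rewrite !inE /= => iM jM; apply: A0.
  rewrite edge_relE adjE -val_eqE /=.
  by have := ltn_ord j; have := ltn_ord M; lia.
Qed.

(** The two boundary terms left over by telescoping on either side of M combine
    with det A into the ratio at M, by [ratio_branch_eq]. *)
Lemma DeltaME M (t : 'rV[R]_n) A : in_PG A ->
  DeltaM M t A = \prod_(v < n) ratio A (branch M v) v `^ t 0 v.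
Proof.
move=> [A_ZG A_pos].
have lower_gt0 k : 0 < lower_minor A k by apply: posdef_minor_gt0.
have upper_gt0 k : 0 < upper_minor A k by apply: posdef_minor_gt0.
have rev_lt (i : 'I_n) : (M < rev_ord i)%N = (i < rev_ord M)%N.
  by rewrite /=; have := ltn_ord i; have := ltn_ord M; lia.
have lowerE : \prod_(i < n | (i < M)%N)
      \det (submx_on A (vrange n 0 i)) `^ (t 0 i - t 0 (ordS i)) =
    (\prod_(v < n | (v < M)%N) ratio A (branch M v) v `^ t 0 v) *
    lower_minor A M `^ (- t 0 M).
  under [in RHS]eq_bigr => v vM do rewrite (ratio_branch_lt A vM).
  exact: (powR_telescope_ord M (t 0) lower_gt0 (lower_minor0 A)).
have upperE : \prod_(i < n | (M < i)%N)
      \det (submx_on A (vrange n i n.-1)) `^ (t 0 i - t 0 (ord_pred i)) =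
    (\prod_(v < n | (M < v)%N) ratio A (branch M v) v `^ t 0 v) *
    upper_minor A (rev_ord M) `^ (- t 0 M).
  under [in RHS]eq_bigr => v vM do rewrite (ratio_branch_gt A vM).
  rewrite (reindex_inj rev_ord_inj) [in RHS](reindex_inj rev_ord_inj).
  rewrite -[in X in _ `^ (- t 0 X)](rev_ordK M) !(eq_bigl _ _ rev_lt).
  under [in RHS]eq_bigr do rewrite rev_ordK.
  rewrite -(powR_telescope_ord (rev_ord M) (fun i => t 0 (rev_ord i)) upper_gt0 (upper_minor0 A)).
  apply: eq_bigr => i iM.
  congr (minor A _ `^ (_ - t 0 _)).
    by apply/setP=> j; rewrite !inE /=; have := ltn_ord j; have := ltn_ord i; lia.
  apply/val_inj => /=; have := ltn_ord M; move: iM => /= iM Mn.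
  have iE : (i.+1 %% n = i.+1)%N by rewrite modn_small //; lia.
  have -> : ((n - i.+1 + n).-1 = n - i.+2 + n)%N by lia.
  by rewrite iE modnDr modn_small; lia.
have split_at_M (F : 'I_n -> R) : \prod_v F v =
    (\prod_(v < n | (v < M)%N) F v) * F M * \prod_(v < n | (M < v)%N) F v.
  rewrite (bigD1 M) //= (bigID (fun v : 'I_n => (v < M)%N)) /= mulrA.
  rewrite [F M * _]mulrC; congr (_ * _ * _); apply: eq_bigl => v.
    by rewrite -val_eqE /=; lia.
  by rewrite -val_eqE /=; lia.
rewrite /DeltaM lowerE upperE split_at_M ratio_branch_eq //.
rewrite powRM ?invr_ge0 ?mulr_ge0 ?(ltW (posdef_det_gt0 A_pos)) //;
  try exact: ltW.
rewrite invfM powRM ?invr_ge0 ?(ltW (lower_gt0 _)) ?(ltW (upper_gt0 _)) //.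
rewrite -!powR_inv1 ?(ltW (lower_gt0 _)) ?(ltW (upper_gt0 _)) // -!powRrM !mulN1r.
ring.
Qed.

End Ratios.

Theorem theorem1 (R : realType) (n : nat) (hn : (1 <= n)%N)
    (prec : rel 'I_n) (hprec : strict_total_order prec)
    (helim : eliminating prec) (M : 'I_n) (hM : maximal_for prec M)
    (s : 'rV[R]_n) (y : 'M[R]_n) (hy : in_PG y) :
  delta prec s (proj_E (invmx y)) = Delta prec (- s) y /\
  Delta prec (- s) y = DeltaM M (- s) y.
Proof.
rewrite (deltaE hprec helim hM) // DeltaME // (DeltaE hprec helim hM) //.
split=> //; apply: eq_bigr => v _; rewrite mxE.
have ratio_ge0 : 0 <= ratio y (branch M v) v.
  by rewrite divr_ge0 // ltW // posdef_minor_gt0 //; case: hy.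
by rewrite -powR_inv1 // -powRrM mulN1r.
Qed.
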